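(* Suppose $q>2$. Let $u,v\in[q]^k$ be such that $\mathrm{overlap}(u,u)=\mathrm{overlap}(v,v)=\{k\}$. Then there exist an integer $N\le 11$ and a sequence of words $u=u^{(1)},u^{(2)},\dots,u^{(N-1)},u^{(N)}=v$ in $[q]^k$ with trivial self-overlap such that for any $1\le i<N$, either $u^{(i+1)}$ is obtained from $u^{(i)}$ by permuting the alphabet or $$\mathrm{overlap}(u^{(i)},u^{(i+1)})=\mathrm{overlap}(u^{(i+1)},u^{(i)})=\emptyset.$$ Consequently, there is a chain of swap conjugacies from $X_{\{u\}}$ to $X_{\{v\}}$, and the length of the chain is upper bounded by $11$.
   Context: $[q]=\{0,\dots,q-1\}$, and $k$ is a positive integer. For words $u,v$ of length $k$ over $[q]$, $\mathrm{overlap}(u,v)=\{i\in\{1,\dots,k\}: v_1\cdots v_i=u_{k-i+1}\cdots u_k\}$. A word $w$ of length $k$ has trivial self-overlap if $\mathrm{overlap}(w,w)=\{k\}$. $X_{\{w\}}\subset[q]^{\mathbb Z}$ is the set of bi-infinite sequences not containing $w$. A conjugacy between shift spaces is a bijective sliding block code. A swap conjugacy between $X_{\{u\}}$ and $X_{\{v\}}$ is a conjugacy of one of two types: the one given by replacing every appearance of $v$ by $u$ and every appearance of $u$ by $v$ (simultaneously) in a sequence, or the one given by applying letterwise a permutation of the alphabet taking $u$ to $v$. A chain of swap conjugacies from $X_{\{u\}}$ to $X_{\{v\}}$ is a sequence $X_{\{u^{(1)}\}},\dots,X_{\{u^{(N)}\}}$ with $u^{(1)}=u$, $u^{(N)}=v$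 and a swap conjugacy between each consecutive pair. *)

(* Defs.v *)
From mathcomp Require Import all_boot all_order all_algebra.
From mathcomp Require Import perm.
(* Required but not imported: [set0] and the set comprehensions below must keep
   denoting finite sets. *)
From mathcomp Require classical_sets functions.

Set Implicit Arguments.
Unset Strict Implicit.
Unset Printing Implicit Defensive.

(* The alphabet [q] is 'I_q, a word of length k over it is a k.-tuple 'I_q. *)

(* Overlap lengths range over 'I_k.+1 = {0, ..., k}; length 0 is excluded. *)
Definition overlap (q k : nat) (u v : k.-tuple 'I_q) : {set 'I_k.+1} :=
  [set i : 'I_k.+1 | (0 < i) && (take i v == drop (k - i) u)].

Definition trivial_self_overlap (q k : nat) (w : k.-tuple 'I_q) : Prop :=
  overlap w w = [set ord_max].

Definition permute_letters (q k : nat) (s : {perm 'I_q}) (w : k.-tuple 'I_q) :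
  k.-tuple 'I_q := [tuple of map s w].

Definition occurs_at (q k : nat) (w : k.-tuple 'I_q) (x : int -> 'I_q)
    (m : int) : Prop :=
  forall j : 'I_k, x (m + j%:Z)%R = tnth w j.

(* X_{w} *)
Definition subshift (q k : nat) (w : k.-tuple 'I_q) :
    classical_sets.set (int -> 'I_q) :=
  fun x => forall m : int, ~ occurs_at w x m.

(* F is given on X by a block map with memory m and anticipation a; the values
   of F outside X are irrelevant. *)
Definition sliding_block_code (q : nat) (X : classical_sets.set (int -> 'I_q))
    (F : (int -> 'I_q) -> (int -> 'I_q)) : Prop :=
  exists (m a : nat) (Phi : (m + a).+1.-tuple 'I_q -> 'I_q),
    forall x : int -> 'I_q, X x -> forall i : int,
      F x i = Phi [tuple x (i - m%:Z + (j : nat)%:Z)%R | j < (m + a).+1].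

Definition conjugacy (q : nat) (X Y : classical_sets.set (int -> 'I_q))
    (F : (int -> 'I_q) -> (int -> 'I_q)) : Prop :=
  sliding_block_code X F /\ functions.set_bij X Y F.

Definition covered (q k : nat) (w : k.-tuple 'I_q) (x : int -> 'I_q)
    (n : int) : Prop :=
  exists (m : int) (j : 'I_k), occurs_at w x m /\ n = (m + j%:Z)%R.

(* y is the result of simultaneously replacing every appearance of u in x by v
   and every appearance of v in x by u. Each coordinate of y is constrained, so
   y is unique; it fails to exist exactly when overlapping appearances make
   conflicting demands. *)
Definition swapped (q k : nat) (u v : k.-tuple 'I_q) (x y : int -> 'I_q) :
    Prop :=
  [/\ forall m : int, occurs_at u x m -> occurs_at v y m,
      forall m : int, occurs_at v x m -> occurs_at u y m &
      forall n : int, ~ covered u x n -> ~ covered v x n -> y n = x n].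

Definition swap_conjugacy (q k : nat) (u v : k.-tuple 'I_q)
    (F : (int -> 'I_q) -> (int -> 'I_q)) : Prop :=
  conjugacy (subshift u) (subshift v) F /\
  ((forall x : int -> 'I_q, subshift u x -> swapped u v x (F x)) \/
   (exists s : {perm 'I_q}, permute_letters s u = v /\
      forall x : int -> 'I_q, subshift u x -> forall n : int, F x n = s (x n))).

(* The chain X_{w 1}, ..., X_{w N}, of length N; w is only used on 1, ..., N. *)
Definition swap_conjugacy_chain (q k : nat) (u v : k.-tuple 'I_q) (N : nat)
    (w : nat -> k.-tuple 'I_q) : Prop :=
  [/\ 1 <= N, w 1 = u, w N = v &
      forall i : nat, 1 <= i < N ->
        exists F : (int -> 'I_q) -> (int -> 'I_q),
          swap_conjugacy (w i) (w i.+1) F].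

(* Main.v *)
Require Import Defs.
From mathcomp Require Import all_boot all_order all_algebra.
From mathcomp Require Import perm.
From mathcomp Require boolp.
From mathcomp Require Import zify.

Set Implicit Arguments.
Unset Strict Implicit.
Unset Printing Implicit Defensive.

Import GRing.Theory.

(** Four words suffice: $u$, $a^{k-1}c$, $b^{k-1}d$, $v$. Let $a$ be the first
    letter of $u$ and let $x$ be the first letter of $u$ that differs from $a$
    (when $k = 1$ there is none, and any $c \neq a$ will do). As there are at least three letters, some $c$ is neither $a$ nor $x$, and
    then $u$ and $a^{k-1}c$ have no overlap in either order
    ([link_to_power_then]). Treating $v$ in the same way gives $b^{k-1}d$, and
    all words of this shape with two distinct letters are related by permutations
    of the alphabet ([perm_two_letters], [permute_power_then]).

    A permutation of letters is clearly a conjugacy. For a link between words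
    without mutual overlaps, the absence of overlaps and of nontrivial
    self-overlaps means that occurrences of $u$ and $v$ in any bi-infinite
    sequence are pairwise disjoint ([disjoint_never_meet]). So the swap is well
    defined on all sequences, by a rule that looks at distance at most $k$
    ([swap_rule_swapped]). Since this disjointness also holds in the image, the
    swap creates no occurrences besides the prescribed ones
    ([swapped_reflects]). Hence it is an involution of the full shift that
    exchanges the occurrences of $u$ with those of $v$, and so maps $X_{\{u\}}$
    bijectively onto $X_{\{v\}}$. *)

(** * Overlaps, letter by letter *)

Lemma overlapP (q k : nat) (x0 : 'I_q) (u v : k.-tuple 'I_q) (i : 'I_k.+1) :
  reflect (0 < i /\ forall j, j < i -> nth x0 v j = nth x0 u (k - i + j))
          (i \in overlap u v).
Proof.
have leik : i <= k by rewrite -ltnS.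
rewrite inE; apply: (iffP andP) => -[i_gt0 uv]; split=> //.
  by move=> j ltji; rewrite -(nth_take x0 ltji) (eqP uv) nth_drop.
apply/eqP/(@eq_from_nth _ x0) => [|j].
  by rewrite size_drop size_takel !size_tuple // subKn.
rewrite size_takel ?size_tuple // => ltji.
by rewrite nth_take // nth_drop uv.
Qed.

Lemma trivial_self_overlapP (q k : nat) (w : k.-tuple 'I_q) :
  0 < k -> (forall i, i \in overlap w w -> i = k :> nat) ->
  trivial_self_overlap w.
Proof.
move=> k_gt0 full; apply/setP=> i; rewrite in_set1.
apply/idP/eqP => [/full ik | ->]; first exact: val_inj.
by rewrite inE /= k_gt0 subnn drop0 take_oversize ?eqxx ?size_tuple.
Qed.

Lemma trivial_self_overlap_full (q k : nat) (w : k.-tuple 'I_q) (i : 'I_k.+1) :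
  trivial_self_overlap w -> i \in overlap w w -> i = k :> nat.
Proof. by rewrite /trivial_self_overlap => ->; rewrite in_set1 => /eqP->. Qed.

(** * The words with a single change of letter, at the end *)

(** The word $a^{k-1}c$. *)
Definition power_then (q k : nat) (a c : 'I_q) : k.-tuple 'I_q :=
  [tuple if j.+1 == k then c else a | j < k].

Lemma nth_power_then (q k : nat) (x0 a c : 'I_q) (i : nat) :
  i < k -> nth x0 (power_then k a c) i = if i.+1 == k then c else a.
Proof. by move=> ltik; rewrite -(tnth_nth x0 _ (Ordinal ltik)) tnth_mktuple. Qed.

Lemma power_then_trivial (q k : nat) (a c : 'I_q) :
  0 < k -> a != c -> trivial_self_overlap (power_then k a c).
Proof.
move=> k_gt0 neq_ac; apply: trivial_self_overlapP => // i.
case/(overlapP a) => i_gt0 /(_ i.-1); rewrite prednK // => /(_ (leqnn _)).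
have leik : i <= k by rewrite -ltnS.
rewrite !nth_power_then ?prednK //; try lia.
case: eqP => // neq_ik; rewrite ifT => [eq_ac|]; last lia.
by rewrite eq_ac eqxx in neq_ac.
Qed.

Lemma third_letter (q : nat) (a b : 'I_q) :
  2 < q -> exists c : 'I_q, (c != a) && (c != b).
Proof.
move=> q_gt2; suff /subsetPn[c _]: ~~ ([set: 'I_q] \subset [set a; b]).
  by rewrite !inE negb_or => nc; exists c.
apply/negP=> /subset_leq_card; rewrite cardsT card_ord cards2 => le_q.
by have := leq_trans q_gt2 le_q; case: (_ == _).
Qed.

(** If [u] begins with $a^m x$ where $x \neq a$, then choosing [c] outside
    $\{a, x\}$ is what separates [u] from $a^{k-1}c$: a suffix $a^{i-1}c$ cannot
    be a prefix of [u], because the first letter of [u] other than [a] is not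
    [c]; a proper prefix $a^i$ cannot be a suffix of [u], because an unbordered
    word of length at least 2 does not end with its first letter; and the two
    words differ where [u] has its first [x]. *)
Lemma link_to_power_then (q k : nat) (u : k.-tuple 'I_q) :
  2 < q -> 0 < k -> trivial_self_overlap u ->
  exists a c : 'I_q, [/\ a != c,
    overlap u (power_then k a c) = set0 & overlap (power_then k a c) u = set0].
Proof.
move=> q_gt2 k_gt0 triv_u.
pose a := tnth u (Ordinal k_gt0); pose m := find (predC1 a) u.
(* When k = 1 every letter of u is a, and the default makes x equal to a. *)
pose x := nth a u m.
have [c /andP[neq_ca neq_cx]] := third_letter a x q_gt2.
have before_m j : j < m -> nth a u j = a.
  by move/(before_find a)/negbFE/eqP.
(* The letter after an initial block of a's is a or x, never c. *)
have c_not_after_a j : j < k -> (forall l, l < j -> nth a u l = a) ->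
    nth a u j != c.
  move=> ltjk eq_a; apply/eqP => uj; case: (ltngtP j m) => [ltjm|ltmj|eq_jm].
  - by rewrite -uj before_m ?eqxx in neq_ca.
  - have /(nth_find a) : has (predC1 a) u.
      by rewrite has_find size_tuple (ltn_trans ltmj).
    by rewrite /= -/m eq_a ?eqxx.
  - by rewrite -uj eq_jm eqxx in neq_cx.
exists a, c; split; first by rewrite eq_sym.
- apply/setP=> i; rewrite in_set0; apply/negP.
  case/(overlapP a) => i_gt0 eq_uw.
  have leik : i <= k by rewrite -ltnS.
  have [eq_ik | ne_ik] := eqVneq (i : nat) k.
    rewrite eq_ik subnn in eq_uw.
    suff /negP[] : nth a u k.-1 != c.
      by rewrite -[k.-1]add0n -eq_uw ?nth_power_then ?prednK ?eqxx.
    apply: c_not_after_a => [|l ltl]; first by rewrite prednK.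
    by rewrite -[l]add0n -eq_uw ?nth_power_then ?ifF //; lia.
  (* A proper prefix of the power word ends with a, so u would have its first
     letter also as its last, an overlap of length 1 < k. *)
  have k_gt1 : 1 < k.+1 by [].
  have /(trivial_self_overlap_full triv_u) /= : Ordinal k_gt1 \in overlap u u.
    apply/(overlapP a); split=> // -[|//] _ /=.
    have := eq_uw i.-1; rewrite prednK // => /(_ (leqnn _)).
    rewrite nth_power_then ?ifF; try lia.
    rewrite (_ : k - i + i.-1 = k - 1 + 0) => [<-|]; last lia.
    by rewrite -(tnth_nth a u (Ordinal k_gt0)).
  lia.
- apply/setP=> i; rewrite in_set0; apply/negP.
  case/(overlapP a) => i_gt0 eq_wu.
  have leik : i <= k by rewrite -ltnS.
  suff /negP[] : nth a u i.-1 != c.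
    by rewrite eq_wu ?nth_power_then ?ifT ?eqxx //; lia.
  apply: c_not_after_a => [|l ltl]; first lia.
  by rewrite eq_wu ?nth_power_then ?ifF //; lia.
Qed.

Lemma perm_two_letters (T : finType) (a c a' c' : T) :
  a != c -> a' != c' -> exists s : {perm T}, s a = a' /\ s c = c'.
Proof.
move=> neq_ac neq_ac'; exists (tperm a a' * tperm (tperm a a' c) c')%g.
rewrite !permM tpermL; split; last by rewrite tpermL.
rewrite tpermD // 1?eq_sym //.
by rewrite -{1}(tpermL a a') (inj_eq perm_inj).
Qed.

Lemma permute_power_then (q k : nat) (s : {perm 'I_q}) (a c : 'I_q) :
  permute_letters s (power_then k a c) = power_then k (s a) (s c).
Proof. by apply: eq_from_tnth => j; rewrite tnth_map !tnth_mktuple; case: ifP. Qed.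

Definition swap_link (q k : nat) (u v : k.-tuple 'I_q) : Prop :=
  (exists s : {perm 'I_q}, v = permute_letters s u) \/
  (overlap u v = set0 /\ overlap v u = set0).

Lemma four_word_chain (q k : nat) (u v : k.-tuple 'I_q) :
  2 < q -> 0 < k -> trivial_self_overlap u -> trivial_self_overlap v ->
  exists w : nat -> k.-tuple 'I_q,
    [/\ w 1 = u, w 4 = v,
        forall i, 1 <= i <= 4 -> trivial_self_overlap (w i) &
        forall i, 1 <= i < 4 -> swap_link (w i) (w i.+1)].
Proof.
move=> q_gt2 k_gt0 triv_u triv_v.
have [a [c [neq_ac ou ou']]] := link_to_power_then q_gt2 k_gt0 triv_u.
have [b [d [neq_bd ov ov']]] := link_to_power_then q_gt2 k_gt0 triv_v.
(* The chain is indexed from 1; the first entry of the list is a filler. *)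
exists (nth u [:: u; u; power_then k a c; power_then k b d; v]).
split=> // -[|[|[|[|[|i]]]]] //= _; try exact: power_then_trivial.
- by right.
- left; have [s [sa sc]] := perm_two_letters neq_ac neq_bd.
  by exists s; rewrite permute_power_then sa sc.
- by right.
Qed.

(** * Letter permutations are conjugacies *)

Lemma permute_swap_conjugacy (q k : nat) (u : k.-tuple 'I_q)
    (s : {perm 'I_q}) :
  exists F, swap_conjugacy u (permute_letters s u) F.
Proof.
have occ (x : int -> 'I_q) m :
    occurs_at (permute_letters s u) (s \o x) m <-> occurs_at u x m.
  split=> occ j; last by rewrite /= occ tnth_map.
  by have := occ j; rewrite tnth_map => /perm_inj.
exists (fun x => s \o x); split; last by right; exists s.
split.
  exists 0, 0, (fun t => s (tnth t ord0)) => x _ i /=.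
  by rewrite tnth_mktuple subr0 addr0.
split=> [x ux m /occ|x y _ _ /= sxy|y vy]; first exact: ux.
  by apply/boolp.funext => n; apply: (@perm_inj _ s); apply: (congr1 (@^~ n) sxy).
have sK : s \o (s^-1%g \o y) = y by apply/boolp.funext => n /=; rewrite permKV.
by exists (s^-1%g \o y) => // m /occ; rewrite sK; apply: vy.
Qed.

(** * Swapping two words is a conjugacy *)

Lemma overlap_of_occurrences (q k : nat) (u v : k.-tuple 'I_q)
    (x : int -> 'I_q) (m : int) (d : nat) :
  d < k -> occurs_at u x m -> occurs_at v x (m + d%:Z)%R ->
  exists2 i, i \in overlap u v & i = k - d :> nat.
Proof.
move=> ltdk occu occv.
have lti : k - d < k.+1 by rewrite ltnS leq_subr.
exists (Ordinal lti) => //; apply/(overlapP (x m)); split=> [|j /= ltj].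
  by rewrite subn_gt0.
have ltjk : j < k by apply: leq_trans ltj (leq_subr _ _).
have ltdjk : d + j < k by lia.
rewrite subKn; last exact: ltnW.
rewrite -(tnth_nth _ _ (Ordinal ltjk)) -(tnth_nth _ _ (Ordinal ltdjk)).
by rewrite -occu -occv /= PoszD addrA.
Qed.

(** The form in which the absence of overlaps is used: it makes the simultaneous
    replacement free of conflicts. *)
Definition never_meet (q k : nat) (u v : k.-tuple 'I_q) : Prop :=
  forall (x : int -> 'I_q) (w w' : k.-tuple 'I_q) (m m' : int) (j j' : 'I_k),
    w \in [:: u; v] -> w' \in [:: u; v] ->
    occurs_at w x m -> occurs_at w' x m' -> (m + j%:Z = m' + j'%:Z)%R ->
    [/\ w = w', m = m' & j = j'].

Lemma never_meet_sym (q k : nat) (u v : k.-tuple 'I_q) :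
  never_meet u v -> never_meet v u.
Proof.
have sym w : (w \in [:: v; u]) = (w \in [:: u; v]) by rewrite !inE orbC.
by move=> nm x w w' m m' j j'; rewrite !sym; apply: nm.
Qed.

(** If two occurrences meet at distance $d < k$, the last $k - d$ letters of one
    are the first $k - d$ letters of the other; the only overlaps available are
    the full ones of a word with itself. *)
Lemma disjoint_never_meet (q k : nat) (u v : k.-tuple 'I_q) :
  trivial_self_overlap u -> trivial_self_overlap v ->
  overlap u v = set0 -> overlap v u = set0 -> never_meet u v.
Proof.
move=> triv_u triv_v ouv ovu x w w' m m' j j' uvw uvw' occ occ' eq_n.
have key w1 w2 (p : int) d : w1 \in [:: u; v] -> w2 \in [:: u; v] -> d < k ->
    occurs_at w1 x p -> occurs_at w2 x (p + d%:Z)%R -> w1 = w2 /\ d = 0.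
  move=> uv1 uv2 ltdk occ1 occ2.
  have [i iin eq_i] := overlap_of_occurrences ltdk occ1 occ2.
  move: uv1 uv2; rewrite !inE => /orP[]/eqP w1E /orP[]/eqP w2E;
    move: iin; rewrite {}w1E {}w2E.
  - by move/(trivial_self_overlap_full triv_u) => eq_ik; split=> //; lia.
  - by rewrite ouv in_set0.
  - by rewrite ovu in_set0.
  - by move/(trivial_self_overlap_full triv_v) => eq_ik; split=> //; lia.
have [ltjk ltjk'] := (ltn_ord j, ltn_ord j').
have [le_j|lt_j] := leqP j' j.
  have m'E : m' = (m + (j - j')%N%:Z)%R by lia.
  rewrite m'E in occ'; have ltd : j - j' < k by lia.
  have [-> d0] := key _ _ _ _ uvw uvw' ltd occ occ'.
  by split=> //; [lia | apply: val_inj => /=; lia].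
have mE : m = (m' + (j' - j)%N%:Z)%R by lia.
rewrite mE in occ; have ltd : j' - j < k by lia.
have [-> d0] := key _ _ _ _ uvw' uvw ltd occ' occ.
by split=> //; [lia | apply: val_inj => /=; lia].
Qed.

Lemma swappedC (q k : nat) (u v : k.-tuple 'I_q) (x y : int -> 'I_q) :
  swapped u v x y -> swapped v u x y.
Proof. by case=> uv vu out; split=> // n nv nu; apply: out. Qed.

Lemma swapped_unique (q k : nat) (u v : k.-tuple 'I_q) (x y z : int -> 'I_q) :
  swapped u v x y -> swapped u v x z -> y = z.
Proof.
case=> uv vu out [uv' vu' out']; apply/boolp.funext => n.
have [[m [j [occ ->]]]|nu] := boolp.pselect (covered u x n).
  by rewrite (uv _ occ) (uv' _ occ).
have [[m [j [occ ->]]]|nv] := boolp.pselect (covered v x n).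
  by rewrite (vu _ occ) (vu' _ occ).
by rewrite out ?out'.
Qed.

(** Swapping creates no new occurrence: an occurrence of [v] in [y] either
    avoids the replaced places, and was then already in [x] and should have been
    replaced, or meets one of the replaced places and then coincides with it. *)
Lemma swapped_reflects (q k : nat) (u v : k.-tuple 'I_q) (x y : int -> 'I_q)
    (m : int) :
  never_meet u v -> swapped u v x y -> occurs_at v y m -> occurs_at u x m.
Proof.
move=> nm [uv vu out] occ.
have [uin vin] : u \in [:: u; v] /\ v \in [:: u; v] by rewrite !inE !eqxx orbT.
(* An occurrence of u in x became one of v in y, which meets the given one. *)
have covu (j : 'I_k) : covered u x (m + j%:Z)%R -> occurs_at u x m.
  case=> m' [j' [occ' eq_n]].
  by have [_ -> _] := nm _ _ _ _ _ _ _ vin vin occ (uv _ occ') eq_n.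
(* Here u now stands in y where v stood in x, so the meeting forces u = v. *)
have covv (j : 'I_k) : covered v x (m + j%:Z)%R -> occurs_at u x m.
  case=> m' [j' [occ' eq_n]].
  by have [<- -> _] := nm _ _ _ _ _ _ _ vin uin occ (vu _ occ') eq_n.
have [[j /covu//]|nu] := boolp.pselect (exists j : 'I_k, covered u x (m + j%:Z)%R).
have [[j /covv//]|nv] := boolp.pselect (exists j : 'I_k, covered v x (m + j%:Z)%R).
have occx : occurs_at v x m.
  by move=> j; rewrite -out ?occ // => cov; [apply: nu | apply: nv]; exists j.
by move=> j; case: nv; exists j; exists m, j.
Qed.

(** [x] and [y] have their occurrences, exchanged, at the same places, so the
    swap of [y] is [x]: this is why swapping is an involution. *)
Lemma swapped_sym (q k : nat) (u v : k.-tuple 'I_q) (x y : int -> 'I_q) :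
  never_meet u v -> swapped u v x y -> swapped u v y x.
Proof.
move=> nm sw; have sw' := swappedC sw.
have yu m : occurs_at u y m -> occurs_at v x m.
  exact: swapped_reflects (never_meet_sym nm) sw'.
have yv m : occurs_at v y m -> occurs_at u x m by apply: swapped_reflects sw.
have [uv vu out] := sw.
by split=> // n nu nv; rewrite out // => -[m [j [occ n_eq]]];
  [apply: nv | apply: nu]; exists m, j; split=> //; [apply: uv | apply: vu].
Qed.

Definition window (q : nat) (r : nat) (x : int -> 'I_q) (n : int) :
  (r + r).+1.-tuple 'I_q :=
  [tuple x (n - r%:Z + (j : nat)%:Z)%R | j < (r + r).+1].

(** [occurs_around w t j]: in the window [t] centred at 0, the word [w] occurs
    at position $-j$, so that its letter of index [j] sits at the centre. *)
Definition occurs_around (q k : nat) (w : k.-tuple 'I_q)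
    (t : (k + k).+1.-tuple 'I_q) (j : 'I_k) : bool :=
  [forall i : 'I_k, tnth t (inord (k - j + i)) == tnth w i].

Definition swap_rule (q k : nat) (u v : k.-tuple 'I_q)
    (t : (k + k).+1.-tuple 'I_q) : 'I_q :=
  if [pick j | occurs_around u t j] is Some j then tnth v j else
  if [pick j | occurs_around v t j] is Some j then tnth u j else
  tnth t (inord k).

Lemma occurs_aroundP (q k : nat) (w : k.-tuple 'I_q) (x : int -> 'I_q)
    (n : int) (j : 'I_k) :
  reflect (occurs_at w x (n - j%:Z)%R) (occurs_around w (window k x n) j).
Proof.
have ltjk := ltn_ord j.
have eq_x (i : 'I_k) :
    tnth (window k x n) (inord (k - j + i)) = x (n - j%:Z + i%:Z)%R.
  have ltik := ltn_ord i.
  rewrite tnth_mktuple inordK; last lia.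
  by congr x; lia.
by apply: (iffP forallP) => occ i; have := occ i; rewrite eq_x => /eqP.
Qed.

Lemma swap_rule_swapped (q k : nat) (u v : k.-tuple 'I_q) (x : int -> 'I_q) :
  never_meet u v -> swapped u v x (fun n => swap_rule u v (window k x n)).
Proof.
move=> nm.
have [uin vin] : u \in [:: u; v] /\ v \in [:: u; v] by rewrite !inE !eqxx orbT.
have meet w w' m (i j : 'I_k) : w \in [:: u; v] -> w' \in [:: u; v] ->
    occurs_at w x m -> occurs_at w' x (m + i%:Z - j%:Z)%R -> w = w' /\ i = j.
  move=> win win' occ occ'.
  by have [|-> _ ->] := nm x _ _ m _ i j win win' occ occ'; first lia.
split=> [m occ i | m occ i | n nu nv]; rewrite /swap_rule.
- case: pickP => [j /occurs_aroundP occ'|/(_ i)/occurs_aroundP[]].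
    by have [_ ->] := meet _ _ _ _ _ uin uin occ occ'.
  by rewrite addrK.
- case: pickP => [j /occurs_aroundP occ'|_].
    by have [-> ->] := meet _ _ _ _ _ vin uin occ occ'.
  case: pickP => [j /occurs_aroundP occ'|/(_ i)/occurs_aroundP[]].
    by have [_ ->] := meet _ _ _ _ _ vin vin occ occ'.
  by rewrite addrK.
- case: pickP => [j /occurs_aroundP occ|_].
    by case: nu; exists (n - j%:Z)%R, j; rewrite subrK.
  case: pickP => [j /occurs_aroundP occ|_].
    by case: nv; exists (n - j%:Z)%R, j; rewrite subrK.
  rewrite tnth_mktuple inordK; last lia.
  by congr x; lia.
Qed.

Lemma swap_swap_conjugacy (q k : nat) (u v : k.-tuple 'I_q) :
  never_meet u v -> exists F, swap_conjugacy u v F.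
Proof.
move=> nm; pose F x n := swap_rule u v (window k x n).
have sw x : swapped u v x (F x) by apply: swap_rule_swapped.
have FK x : F (F x) = x by apply: swapped_unique (sw _) (swapped_sym nm (sw x)).
exists F; split; last by left.
split; first by exists k, k, (swap_rule u v).
split=> [x ux m /(swapped_reflects nm (sw x)) | x y _ _ eq_F | y vy].
- exact: ux.
- by rewrite -[x]FK eq_F FK.
- exists (F y) => // m /(swapped_reflects (never_meet_sym nm) (swappedC (sw y))).
  exact: vy.
Qed.

(** * Chains *)

Lemma swap_link_conjugacy (q k : nat) (u v : k.-tuple 'I_q) :
  trivial_self_overlap u -> trivial_self_overlap v -> swap_link u v ->
  exists F, swap_conjugacy u v F.
Proof.
move=> triv_u triv_v [[s ->]|[ouv ovu]]; first exact: permute_swap_conjugacy.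
by apply: swap_swap_conjugacy; apply: disjoint_never_meet.
Qed.

Theorem theorem4p9 (q k : nat) (hq : 2 < q) (hk : 0 < k)
    (u v : k.-tuple 'I_q)
    (hu : overlap u u = [set ord_max]) (hv : overlap v v = [set ord_max]) :
  (exists (N : nat) (w : nat -> k.-tuple 'I_q),
     [/\ 1 <= N <= 11, w 1 = u, w N = v,
         forall i : nat, 1 <= i <= N -> trivial_self_overlap (w i) &
         forall i : nat, 1 <= i < N ->
           (exists s : {perm 'I_q}, w i.+1 = permute_letters s (w i)) \/
           (overlap (w i) (w i.+1) = set0 /\ overlap (w i.+1) (w i) = set0)])
  /\
  (exists (N : nat) (w : nat -> k.-tuple 'I_q),
     swap_conjugacy_chain u v N w /\ N <= 11).
Proof.
have [w [w1 w4 triv link]] := four_word_chain hq hk hu hv.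
split; first by exists 4, w.
exists 4, w; split=> //; split=> // i /andP[i_gt0 lti4].
apply: swap_link_conjugacy; [apply: triv | apply: triv | apply: link]; lia.
Qed.
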